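(* Let $m\in\mathbb N_0$, $q\in\mathbb C$ with $0<|q|<1$, and $a,b,t\in\mathbb C\setminus\{0\}$ with $qa,\,q^2abt,\,\sqrt{qab},\,-\sqrt{qab}\notin\{q^{-k}:k\in\mathbb N_0\}$. Then the little $q$-Jacobi polynomials $p_n(x;a,b;q)$ satisfy $$\sum_{n=0}^\infty t^n\,\frac{(qab,\sqrt{q^3ab},-\sqrt{q^3ab},t^{-1};q)_n}{(q,\sqrt{qab},-\sqrt{qab},q^2abt;q)_n}\;p_n(q^m;a,b;q)=\frac{(q^2ab,qat;q)_\infty}{(qa,q^2abt;q)_\infty}\,t^m .$$
   Context: $\mathbb N_0=\{0,1,2,\dots\}$. $(a;q)_n=\prod_{j=0}^{n-1}(1-aq^j)$ for $n\in\mathbb N_0\cup\{\infty\}$, $(a_1,\dots,a_k;q)_n=\prod_i(a_i;q)_n$. The little $q$-Jacobi polynomials are $$p_n(x;a,b;q)=\sum_{k=0}^n\frac{(q^{-n},q^{n+1}ab;q)_k}{(q,qa;q)_k}(qx)^k .$$ The square roots enter only through $(w,-w;q)_n=(w^2;q^2)_n$, so their choice is immaterial. *)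

(* Defs.v *)
From Stdlib Require Import Reals.
From Coquelicot Require Import Coquelicot.
Open Scope C_scope.

Fixpoint qpoch (a q : C) (n : nat) : C :=
  match n with
  | O => 1
  | S k => qpoch a q k * (1 - a * q ^ k)
  end.

(* $(a;q)_\infty$. [Lim_seq] is total, so this is the genuine infinite product
   only when the partial products converge, as they do for |q| < 1; see
   [qpoch_inf_unique]. *)
Definition qpoch_inf (a q : C) : C :=
  (real (Lim_seq (fun n => Re (qpoch a q n))),
   real (Lim_seq (fun n => Im (qpoch a q n)))).

Lemma qpoch_inf_unique (a q l : C) :
  filterlim (qpoch a q) eventually (locally l) -> qpoch_inf a q = l.
Proof.
intros H; destruct l as [x y]; unfold qpoch_inf.
apply (f_equal2 (@pair R R)).
- rewrite (is_lim_seq_unique _ x); [reflexivity|].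
  intros P [e He]; apply (H (fun z => P (fst z))).
  exists e; intros z [Hz _]; exact (He _ Hz).
- rewrite (is_lim_seq_unique _ y); [reflexivity|].
  intros P [e He]; apply (H (fun z => P (snd z))).
  exists e; intros z [_ Hz]; exact (He _ Hz).
Qed.

(* Little q-Jacobi polynomial $p_n(x;a,b;q)$; the powers $q^{-n}$ of the
   literature are written [/ q ^ n]. *)
Definition little_qJacobi (n : nat) (x a b q : C) : C :=
  sum_n (fun k =>
    (qpoch (/ q ^ n) q k * qpoch (q ^ (n + 1) * a * b) q k)
      / (qpoch q q k * qpoch (q * a) q k) * (q * x) ^ k) n.

(* Main.v *)
Require Import Defs.
From Stdlib Require Import Reals Lra Lia.
From Coquelicot Require Import Coquelicot.
Open Scope C_scope.

(** Write [(x)_n] for [qpoch x q n], [p_n(x)] for the little q-Jacobi polynomial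
    and [[x, y]_n] for the product of the [x - y q^j], [j < n].

    The sum is linear in the polynomial that is evaluated. Indeed [p_n(x)] is a
    combination, with weights depending on [n] and [k], of the powers [(q x)^k],
    and at [x = q^m] the power [x^k] is [(q^k)^m]. So the left-hand side is a
    functional applied to the monomial [X^m], which it only sees through its
    values at the points [q^k], and the claim is that this functional is a
    constant times evaluation at [t]. The polynomials [[X, 1]_j] form a basis
    well suited to it: [[q^k, 1]_j] vanishes for [k < j] and otherwise
    cancels the last [j] factors of [(q)_k]. Removing one factor at a time turns the
    claim for [[X, 1]_(j+1)] and parameters [(a, b, t)] into the claim for
    [[X, 1]_j] and [(q a, q b, t/q)], with [n] and [k] lowered by one
    ([kernel_jacobi_sum_shift], [expands_qfall]). The monomials follow from
    [X [X, 1]_j = [X, 1]_(j+1) + q^j [X, 1]_j] ([expands_pow_qfall]).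

    What is left is the constant polynomial, where the inner sum is [p_n(1)] and
    the q-Chu-Vandermonde formula ([q_Chu_Vandermonde]) evaluates it to
    [[0, q a]_n (q b)_n / (q a)_n]. The outer sum becomes the limiting case,
    with one numerator parameter sent to infinity, of the nonterminating
    very-well-poised 6phi5 series. It satisfies
    [(1 - q a)(1 - q^2 a b t) S(a) = (1 - q^2 a b)(1 - q a t) S(q a)],
    because the difference telescopes termwise ([vwp_telescope]). Iterating
    sends the parameter [a] to [0], where only the term [n = 0] survives, and
    the accumulated factors converge to the four infinite products
    ([vwp_series]). The exchange of limits is licensed by a majorant that is
    uniform along [a, q a, q^2 a, ...] and summable, since [[0, q a]_n] decays
    like [q^(n^2/2)]; this decay is also why the series converges for every
    [t]. *)

(** * Finite q-products *)

(** The condition under which every [(x;q)_n] can stand in a denominator. It is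
    inherited by [q x], which is what the shifts of parameters below need. *)
Definition regular (x q : C) : Prop := forall k : nat, x * q ^ k <> 1.

Lemma regular_shift (x q : C) : regular x q -> regular (q * x) q.
Proof.
  intros H k E; apply (H (S k)); rewrite <- E, Cpow_S; ring.
Qed.

Lemma regular_neq_1 (x q : C) (k : nat) : regular x q -> 1 - x * q ^ k <> 0.
Proof.
  intros H E; apply (H k).
  replace (x * q ^ k) with (1 - (1 - x * q ^ k)) by ring; rewrite E; ring.
Qed.

Lemma qpoch_neq_0 (x q : C) (n : nat) : regular x q -> qpoch x q n <> 0.
Proof.
  intros H; induction n as [|n IH]; simpl.
  - exact C1_nz.
  - apply Cmult_neq_0; [exact IH|apply regular_neq_1, H].
Qed.

Lemma regular_head (x q : C) : regular x q -> 1 - x <> 0.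
Proof.
  intros H; generalize (regular_neq_1 x q 0 H); simpl.
  now rewrite Cmult_1_r.
Qed.

Lemma regular_base (q : C) : (Cmod q < 1)%R -> regular q q.
Proof.
  intros Hq k E.
  assert (H : (Cmod q ^ S k = 1)%R).
  { rewrite <- Cmod_pow, Cpow_S, E; apply Cmod_1. }
  assert (H' : (Cmod q ^ S k <= Cmod q)%R).
  { simpl; rewrite <- (Rmult_1_r (Cmod q)) at 3.
    apply Rmult_le_compat_l; [apply Cmod_ge_0|].
    rewrite <- (pow1 k); apply pow_incr; split; [apply Cmod_ge_0|lra]. }
  lra.
Qed.

Lemma qpoch_S (x q : C) (n : nat) :
  qpoch x q (S n) = qpoch x q n * (1 - x * q ^ n).
Proof. reflexivity. Qed.

Lemma qpoch_S_l (x q : C) (n : nat) :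
  qpoch x q (S n) = (1 - x) * qpoch (q * x) q n.
Proof.
  induction n as [|n IH].
  - simpl; ring.
  - rewrite qpoch_S, IH, (qpoch_S (q * x)), Cpow_S; ring.
Qed.

Lemma qpoch_add (x q : C) (s n : nat) :
  qpoch x q (s + n) = qpoch x q s * qpoch (x * q ^ s) q n.
Proof.
  induction n as [|n IH].
  - rewrite Nat.add_0_r; simpl; ring.
  - rewrite Nat.add_succ_r, !qpoch_S, IH, Cpow_add_r; ring.
Qed.

(** The homogeneous form of the shifted factorial: it is a polynomial in [x] and
    [y] alike, and at [x = 0] it is [(-y)^n q^(n(n-1)/2)]. *)
Fixpoint qfall (x y q : C) (n : nat) : C :=
  match n with
  | O => 1
  | S k => qfall x y q k * (x - y * q ^ k)
  end.

Lemma qfall_S (x y q : C) (n : nat) :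
  qfall x y q (S n) = qfall x y q n * (x - y * q ^ n).
Proof. reflexivity. Qed.

Lemma qfall_S_l (x y q : C) (n : nat) :
  qfall x y q (S n) = (x - y) * qfall x (q * y) q n.
Proof.
  induction n as [|n IH].
  - simpl; ring.
  - rewrite qfall_S, IH, (qfall_S x (q * y)), Cpow_S; ring.
Qed.

Lemma qfall_scale (c x y q : C) (n : nat) :
  qfall (c * x) (c * y) q n = c ^ n * qfall x y q n.
Proof.
  induction n as [|n IH]; [simpl; ring|].
  rewrite !qfall_S, IH, Cpow_S; ring.
Qed.

Lemma qfall_qpoch (x q : C) (n : nat) :
  x <> 0 -> x ^ n * qpoch (/ x) q n = qfall x 1 q n.
Proof.
  intros Hx; induction n as [|n IH]; [simpl; ring|].
  rewrite qfall_S, <- IH, qpoch_S, Cpow_S; field; exact Hx.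
Qed.

Lemma qpoch_inv_pow (q : C) (n : nat) : q <> 0 -> qpoch (/ q ^ n) q (S n) = 0.
Proof.
  intros Hq; rewrite qpoch_S.
  replace (1 - / q ^ n * q ^ n) with (RtoC 0); [ring|].
  field; apply Cpow_nz, Hq.
Qed.

(** * Summation of q-hypergeometric terms *)

(* The rules for finite sums, over the concrete operations of [C] on which
   [ring] and [field] work. *)
Lemma C_sum_Sn (f : nat -> C) (n : nat) :
  sum_n f (S n) = sum_n f n + f (S n) :> C.
Proof. exact (sum_Sn f n). Qed.

Lemma C_sum_O (f : nat -> C) : sum_n f 0 = f 0%nat :> C.
Proof. exact (sum_O f). Qed.

Lemma C_sum_head (f : nat -> C) (n : nat) :
  sum_n f (S n) = f 0%nat + sum_n (fun k => f (S k)) n :> C.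
Proof.
  induction n as [|n IH].
  - now rewrite C_sum_Sn, !C_sum_O.
  - rewrite C_sum_Sn, IH, C_sum_Sn; ring.
Qed.

Lemma C_sum_ext (f g : nat -> C) (n : nat) :
  (forall k, (k <= n)%nat -> f k = g k) -> sum_n f n = sum_n g n :> C.
Proof. exact (sum_n_ext_loc f g n). Qed.

Lemma C_sum_scal (c : C) (f : nat -> C) (n : nat) :
  sum_n (fun k => c * f k) n = c * sum_n f n :> C.
Proof. exact (sum_n_mult_l c f n). Qed.

Lemma C_sum_plus (f g : nat -> C) (n : nat) :
  sum_n (fun k => f k + g k) n = sum_n f n + sum_n g n :> C.
Proof. exact (sum_n_plus f g n). Qed.

(** The parameters [B] and [D] are independent of [n], so induction on [n] is
    possible: raising [n] changes the [k]-th term by a multiple of the [k-1]-st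
    term with [B] and [D] replaced by [q B] and [q D]. Writing the right-hand
    side with [qfall] instead of [(D/B;q)_n B^n] admits [B = 0]. *)
Lemma q_Chu_Vandermonde (q B D : C) (n : nat) :
  q <> 0 -> regular q q -> regular D q ->
  sum_n (fun k => qpoch (/ q ^ n) q k * qpoch B q k
                    / (qpoch q q k * qpoch D q k) * q ^ k) n
  = qfall B D q n / qpoch D q n :> C.
Proof.
  intros Hq Hqq; revert B D; induction n as [|n IH]; intros B D HD.
  - rewrite C_sum_O; simpl; field.
  - assert (Hqn : q ^ n <> 0) by apply Cpow_nz, Hq.
    set (u := fun (B D : C) (n k : nat) => qpoch (/ q ^ n) q k * qpoch B q k
                    / (qpoch q q k * qpoch D q k) * q ^ k).
    change (sum_n (u B D (S n)) (S n) = qfall B D q (S n) / qpoch D q (S n) :> C).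
    assert (HD1 := regular_head _ _ HD).
    (* Both sums run to [n + 1], since the extra term has the factor
       [1 - q^(-n) q^n]. *)
    assert (E0 : sum_n (u B D n) (S n) = qfall B D q n / qpoch D q n :> C).
    { rewrite C_sum_Sn; unfold u at 2; rewrite qpoch_inv_pow by exact Hq.
      rewrite <- (IH B D HD); fold (u B D n); unfold Cdiv; ring. }
    assert (E1 : sum_n (u B D (S n)) (S n)
        = sum_n (u B D n) (S n)
          + - (/ q ^ n * ((1 - B) / (1 - D))) * sum_n (u (q * B) (q * D) n) n :> C).
    { rewrite !(C_sum_head (u B D _)), <- C_sum_scal.
      rewrite <- Cplus_assoc, <- C_sum_plus.
      apply f_equal2; [reflexivity|].
      apply C_sum_ext; intros k _; unfold u.
      rewrite (qpoch_S_l (/ q ^ S n)), (qpoch_S (/ q ^ n)), !(qpoch_S_l B),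
        !(qpoch_S_l D), !(qpoch_S q), !Cpow_S.
      replace (q * / (q * q ^ n)) with (/ q ^ n) by (field; auto).
      assert (H1 := qpoch_neq_0 _ _ k Hqq).
      assert (H2 := qpoch_neq_0 _ _ k (regular_shift _ _ HD)).
      assert (H3 := regular_neq_1 _ _ k Hqq).
      field; repeat split; assumption. }
    rewrite E1, E0.
    assert (EI := IH (q * B) (q * D) (regular_shift _ _ HD)).
    fold (u (q * B) (q * D) n) in EI; rewrite EI, qfall_scale, qfall_S.
    assert (H1 := qpoch_neq_0 _ _ n HD).
    assert (H2 := qpoch_neq_0 _ _ n (regular_shift _ _ HD)).
    assert (H3 := regular_neq_1 _ _ n HD).
    (* Both factorizations of [(D)_(n+1)], from the head and from the tail. *)
    replace (qpoch D q n) with ((1 - D) * qpoch (q * D) q n / (1 - D * q ^ n)).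
    2:{ rewrite <- qpoch_S_l, qpoch_S; field; assumption. }
    rewrite qpoch_S_l.
    field; repeat split; assumption.
Qed.

(** The factor of index [j] on the left is [- y q^j (1 - x q^(n-j))]: reading the
    product backwards separates a q-power from a shifted factorial. *)
Lemma qfall_0_mul_qpoch (x y q : C) (n : nat) :
  qfall (q ^ n * (x * y)) y q n = qfall 0 y q n * qpoch (q * x) q n.
Proof.
  induction n as [|n IH]; [simpl; ring|].
  rewrite qfall_S_l.
  replace (q ^ S n * (x * y)) with (q * (q ^ n * (x * y))) at 2
    by (rewrite Cpow_S; ring).
  rewrite qfall_scale, IH, !qfall_S, !qpoch_S, Cpow_S; ring.
Qed.

(** This is [(A)_n (1 - A q^(2n)) / ((q)_n (1 - A))] with the factor [1 - A]
    cancelled. The parameter shifts below reach values [q^i A] that may be [1],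
    so the quotient form would not be usable there. *)
Definition vwp_coef (A q : C) (n : nat) : C :=
  match n with
  | O => 1
  | S k => qpoch (q * A) q k * (1 - A * q ^ (2 * S k)) / qpoch q q (S k)
  end.

Lemma vwp_coef_quotient (A q : C) (n : nat) :
  regular q q -> A <> 1 ->
  qpoch A q n * (1 - A * q ^ (2 * n)) / (qpoch q q n * (1 - A)) = vwp_coef A q n.
Proof.
  intros Hq HA.
  assert (HA1 : 1 - A <> 0).
  { intros E; apply HA; replace A with (1 - (1 - A)) by ring; rewrite E; ring. }
  destruct n as [|k].
  - simpl; field; exact HA1.
  - unfold vwp_coef; rewrite (qpoch_S_l A).
    field; split; [apply qpoch_neq_0, Hq|exact HA1].
Qed.

Lemma vwp_coef_shift (A q : C) (n : nat) :
  (1 - q * A) * vwp_coef (q * A) q (S n)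
  = qpoch (q * A) q (S n) * (1 - q * A * q ^ (2 * S n)) / qpoch q q (S n).
Proof.
  unfold vwp_coef; rewrite (qpoch_S_l (q * A)); unfold Cdiv; ring.
Qed.

(** The part of the [n]-th term that does not involve the polynomial. *)
Definition kernel (q a b t : C) (n : nat) : C :=
  vwp_coef (q * a * b) q n * qfall t 1 q n / qpoch (q ^ 2 * a * b * t) q n.

(** The [n]-th term for the constant polynomial; the second factor is [p_n(1)]. *)
Definition vwp_term (q a b t : C) (n : nat) : C :=
  kernel q a b t n
  * (qfall 0 (q * a) q n * qpoch (q * b) q n / qpoch (q * a) q n).

(** The certificate of the telescoping [vwp_telescope]. *)
Definition vwp_boundary (q a b t : C) (n : nat) : C :=
  - (qpoch (q * (q * a * b)) q n * qfall t 1 q (S n) * qpoch (q * b) q (S n)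
     * qfall 0 (q * a) q (S n))
  / (qpoch q q n * qpoch (q * (q ^ 2 * a * b * t)) q n
     * qpoch (q * (q * a)) q n).

(** A q-Zeilberger recurrence of order one in [a]: after division by the common
    factors, the difference of boundary terms and the combination of summands
    are the same polynomial in [q^n]. The factor [1 - q^2 a b] on the right is
    absorbed by [vwp_coef_shift] and never divided by. *)
Lemma vwp_telescope (q a b t : C) (N : nat) :
  regular q q -> regular (q * a) q -> regular (q ^ 2 * a * b * t) q ->
  (1 - q * a) * (1 - q ^ 2 * a * b * t) * sum_n (vwp_term q a b t) N
  = (1 - q * (q * a * b)) * (1 - q * a * t) * sum_n (vwp_term q (q * a) b t) N
    + vwp_boundary q a b t N :> C.
Proof.
  intros Hq Ha Ht.
  assert (Ha1 := regular_head _ _ Ha).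
  assert (Ht1 := regular_head _ _ Ht).
  induction N as [|N IH].
  - rewrite !C_sum_O; unfold vwp_term, kernel, vwp_boundary; simpl; field.
  - rewrite !C_sum_Sn, !Cmult_plus_distr_l, IH.
    (* The sum has to be opaque before its summand is unfolded elsewhere. *)
    generalize (sum_n (vwp_term q (q * a) b t) N : C); intros s.
    unfold vwp_term, kernel.
    replace (q * (q * a) * b) with (q * (q * a * b)) by ring.
    replace (q ^ 2 * (q * a) * b * t) with (q * (q ^ 2 * a * b * t)) by ring.
    assert (Hv := vwp_coef_shift (q * a * b) q N).
    set (V := vwp_coef (q * (q * a * b)) q (S N)) in *.
    set (Z := _ / qpoch (q * (q * a)) q (S N)).
    replace ((1 - q * (q * a * b)) * (1 - q * a * t)
             * (V * qfall t 1 q (S N) / qpoch (q * (q ^ 2 * a * b * t)) q (S N) * Z))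
      with ((1 - q * (q * a * b)) * V * (1 - q * a * t) * qfall t 1 q (S N)
            / qpoch (q * (q ^ 2 * a * b * t)) q (S N) * Z)
      by (unfold Cdiv; ring).
    rewrite Hv; unfold Z; clear Hv Z V.
    replace (qfall 0 (q * (q * a)) q (S N))
      with (q ^ S N * qfall 0 (q * a) q (S N))
      by (rewrite <- qfall_scale; f_equal; ring).
    unfold vwp_coef, vwp_boundary.
    rewrite (qpoch_S_l (q * a)), (qpoch_S_l (q ^ 2 * a * b * t)).
    rewrite (qfall_S t 1 q (S N)), (qfall_S 0 (q * a) q (S N)), (qpoch_S (q * b) q (S N)).
    rewrite (qpoch_S (q * (q * a))), (qpoch_S (q * (q ^ 2 * a * b * t))),
     (qpoch_S q), (qpoch_S (q * (q * a * b))).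
    assert (H1 := qpoch_neq_0 _ _ N Hq).
    assert (H2 := regular_neq_1 _ _ N Hq).
    assert (H3 := qpoch_neq_0 _ _ N (regular_shift _ _ Ha)).
    assert (H4 := regular_neq_1 _ _ N (regular_shift _ _ Ha)).
    assert (H5 := qpoch_neq_0 _ _ N (regular_shift _ _ Ht)).
    assert (H6 := regular_neq_1 _ _ N (regular_shift _ _ Ht)).
    replace (q ^ (2 * S N)) with (q ^ 2 * (q ^ N * q ^ N))
      by (rewrite <- !Cpow_add_r; f_equal; lia).
    rewrite (Cpow_S q N).
    generalize dependent (qpoch q q N); intros.
    generalize dependent (qpoch (q * (q * a)) q N); intros.
    generalize dependent (qpoch (q * (q ^ 2 * a * b * t)) q N); intros.
    generalize dependent (q ^ N); intros.
    field; repeat split; assumption.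
Qed.

(** * The expansion functional *)

(** The values [f (q^k)] take the place of the [k]-th powers of the argument
    of [p_n]. *)
Definition jacobi_sum (f : C -> C) (n : nat) (a b q : C) : C :=
  sum_n (fun k =>
    (qpoch (/ q ^ n) q k * qpoch (q ^ (n + 1) * a * b) q k)
      / (qpoch q q k * qpoch (q * a) q k) * q ^ k * f (q ^ k)) n.

(** Because [(q^m)^k = (q^k)^m]. *)
Lemma little_qJacobi_sum (m n : nat) (a b q : C) :
  little_qJacobi n (q ^ m) a b q = jacobi_sum (fun x => x ^ m) n a b q.
Proof.
  apply C_sum_ext; intros k _.
  rewrite Cpow_mult_l, <- !Cpow_mult_r, (Nat.mul_comm m k); ring.
Qed.

Lemma jacobi_sum_1 (n : nat) (a b q : C) :
  q <> 0 -> regular q q -> regular (q * a) q ->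
  jacobi_sum (fun _ => 1) n a b q
  = qfall 0 (q * a) q n * qpoch (q * b) q n / qpoch (q * a) q n.
Proof.
  intros Hq Hqq Ha.
  rewrite <- qfall_0_mul_qpoch.
  replace (q ^ n * (b * (q * a))) with (q ^ (n + 1) * a * b)
    by (rewrite Cpow_add_r, Cpow_1_r; ring).
  rewrite <- q_Chu_Vandermonde by assumption.
  apply C_sum_ext; intros k _; ring.
Qed.

(** The ratio of the infinite products at [(a, b, t)] and at [(q a, q b, t/q)],
    see [vwp_value_shift]. *)
Definition shift_factor (q a b t : C) : C :=
  (1 - q * (q * a * b)) * (1 - q * (q * (q * a * b)))
  / ((1 - q * a) * (1 - q ^ 2 * a * b * t)).

(** [[q^(k+1), 1]_(j+1) = (q^(k+1) - 1) q^j [q^k, 1]_j], and [q^(k+1) - 1] cancels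
    against [(q)_(k+1)]. What remains is the same sum for [n] and [k] one lower,
    and the factors [1 - q^(-n-1)] and [1 - q^(n+2) a b] split off in front turn
    the very-well-poised coefficient of index [n + 1] into the one of index [n]
    with [q a b] replaced by [q^3 a b]. *)
Lemma kernel_jacobi_sum_shift (q a b t : C) (j n : nat) :
  q <> 0 -> regular q q -> regular (q * a) q -> regular (q ^ 2 * a * b * t) q ->
  kernel q a b t (S n) * jacobi_sum (fun x => qfall x 1 q (S j)) (S n) a b q
  = (t - 1) * q ^ j * shift_factor q a b t
    * (kernel q (q * a) (q * b) (t / q) n
       * jacobi_sum (fun x => qfall x 1 q j) n (q * a) (q * b) q).
Proof.
  intros Hq Hqq Ha Ht.
  assert (Hqn : forall n, q ^ n <> 0) by (intro; now apply Cpow_nz).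
  assert (Ha1 := regular_head _ _ Ha).
  assert (Ht1 := regular_head _ _ Ht).
  unfold jacobi_sum; rewrite C_sum_head.
  replace (qfall (q ^ 0) 1 q (S j)) with (RtoC 0)
    by (rewrite qfall_S_l; simpl; ring).
  rewrite Cmult_0_r, Cplus_0_l, <- !C_sum_scal.
  apply C_sum_ext; intros k Hk.
  replace (q ^ (S n + 1) * a * b) with (q ^ n * (q * (q * a * b)))
    by (rewrite Cpow_add_r, Cpow_1_r, Cpow_S; ring).
  replace (q ^ (n + 1) * (q * a) * (q * b)) with (q * (q ^ n * (q * (q * a * b))))
    by (rewrite Cpow_add_r, Cpow_1_r; ring).
  rewrite (qpoch_S_l (/ q ^ S n)), (qpoch_S_l (q ^ n * _)), (qpoch_S_l (q * a)).
  replace (q * / q ^ S n) with (/ q ^ n) by (rewrite Cpow_S; field; auto).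
  rewrite qfall_S_l.
  replace (qfall (q ^ S k) (q * 1) q j) with (q ^ j * qfall (q ^ k) 1 q j)
    by (rewrite <- qfall_scale; reflexivity).
  unfold kernel, shift_factor.
  replace (q ^ 2 * (q * a) * (q * b) * (t / q)) with (q * (q ^ 2 * a * b * t))
    by (field; auto).
  rewrite (qpoch_S_l (q ^ 2 * a * b * t)), qfall_S_l.
  replace (qfall t (q * 1) q n) with (q ^ n * qfall (t / q) 1 q n)
    by (rewrite <- qfall_scale; f_equal; field; auto).
  assert (Hv : vwp_coef (q * a * b) q (S n) * (1 - q ^ n * (q * (q * a * b)))
               * (1 - q ^ S n)
    = (1 - q * (q * a * b)) * (1 - q * (q * (q * a * b)))
      * vwp_coef (q * (q * a) * (q * b)) q n).
  { assert (H1 := qpoch_neq_0 _ _ n Hqq).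
    assert (H2 := regular_neq_1 _ _ n Hqq).
    transitivity (qpoch (q * (q * a * b)) q (S n) * (1 - q * a * b * q ^ (2 * S n))
                  / qpoch q q n).
    - unfold vwp_coef; rewrite !qpoch_S, (Cpow_S q n); field; split; assumption.
    - destruct n as [|n].
      + simpl; field.
      + rewrite !(qpoch_S_l (q * (q * a * b))).
        unfold vwp_coef.
        replace (q * (q * (q * a) * (q * b))) with (q * (q * (q * (q * a * b)))) by ring.
        rewrite (qpoch_S_l (q * (q * (q * a * b)))).
        replace (q ^ (2 * S (S n))) with (q ^ 2 * q ^ (2 * S n))
          by (rewrite <- Cpow_add_r; f_equal; lia).
        field; exact H1. }
  assert (H1 := qpoch_neq_0 _ _ k Hqq).
  assert (H2 := regular_neq_1 _ _ k Hqq).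
  assert (H3 := qpoch_neq_0 _ _ k (regular_shift _ _ Ha)).
  assert (H4 := qpoch_neq_0 _ _ n (regular_shift _ _ Ht)).
  rewrite qpoch_S.
  set (V := vwp_coef (q * a * b) q (S n)) in *.
  set (V' := vwp_coef (q * (q * a) * (q * b)) q n) in *.
  (* Everything except the very-well-poised coefficients, so that each side is
     [F] times one side of [Hv]. *)
  set (F := (t - 1) * q ^ j / ((1 - q * a) * (1 - q ^ 2 * a * b * t))
     * (qfall (t / q) 1 q n / qpoch (q * (q ^ 2 * a * b * t)) q n)
     * (qpoch (/ q ^ n) q k * qpoch (q * (q ^ n * (q * (q * a * b)))) q k
       / (qpoch q q k * qpoch (q * (q * a)) q k) * q ^ k * qfall (q ^ k) 1 q j)).
  transitivity (V * (1 - q ^ n * (q * (q * a * b))) * (1 - q ^ S n) * F).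
  - unfold F; rewrite !(Cpow_S q n), !(Cpow_S q k).
    field; repeat split; auto.
  - rewrite Hv; unfold F; field; repeat split; auto.
Qed.

(** * Limits and infinite products *)

(** The norm form of convergence: it reduces limits of complex sequences to real
    ones, where comparison is available. *)
Definition Ctends (u : nat -> C) (l : C) : Prop :=
  is_lim_seq (fun n => Cmod (u n - l)) 0.

Lemma Ctends_filterlim (u : nat -> C) (l : C) :
  filterlim u eventually (locally (l : C_UniformSpace)) <-> Ctends u l.
Proof.
  split; intros H.
  - apply is_lim_seq_spec; intros eps.
    assert (He : (0 < eps / sqrt 2)%R)
      by (apply Rdiv_lt_0_compat; [apply cond_pos|apply sqrt_lt_R0; lra]).
    destruct (proj1 (filterlim_locally u (l : C_UniformSpace)) H (mkposreal _ He))
      as [N HN].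
    exists N; intros n Hn.
    generalize (C_NormedModule_mixin_compat2 l (u n) _ (HN n Hn)); simpl.
    replace (sqrt 2 * (eps / sqrt 2))%R with (pos eps)
      by (field; apply Rgt_not_eq, sqrt_lt_R0; lra).
    intros Hlt; rewrite Rminus_0_r, Rabs_pos_eq by apply Cmod_ge_0.
    exact Hlt.
  - apply (filterlim_locally u (l : C_UniformSpace)); intros eps.
    destruct (proj2 (is_lim_seq_spec _ _) H eps) as [N HN].
    exists N; intros n Hn; apply C_NormedModule_mixin_compat1.
    specialize (HN n Hn); simpl in HN.
    rewrite Rminus_0_r, Rabs_pos_eq in HN by apply Cmod_ge_0.
    exact HN.
Qed.

Lemma Ctends_is_series (u : nat -> C) (l : C) :
  Ctends (fun n => sum_n u n) l -> @is_series C_AbsRing C_NormedModule u l.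
Proof. intros H; apply Ctends_filterlim, H. Qed.

Lemma Ctends_squeeze (u : nat -> C) (l : C) (d : nat -> R) :
  (forall n, (Cmod (u n - l) <= d n)%R) -> is_lim_seq d 0 -> Ctends u l.
Proof.
  intros H Hd.
  apply (is_lim_seq_le_le (fun _ => 0%R) _ d); [|apply is_lim_seq_const|exact Hd].
  intros n; split; [apply Cmod_ge_0|apply H].
Qed.

Lemma Ctends_ext (u v : nat -> C) (l : C) :
  (forall n, u n = v n) -> Ctends u l -> Ctends v l.
Proof.
  intros H; apply is_lim_seq_ext; intros n; now rewrite H.
Qed.

Lemma Ctends_unique (u : nat -> C) (l l' : C) : Ctends u l -> Ctends u l' -> l = l'.
Proof.
  intros H H'.
  assert (Hs : is_lim_seq (fun n => Cmod (u n - l) + Cmod (u n - l'))%R (0 + 0)%R)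
    by (apply is_lim_seq_plus'; assumption).
  assert (Hn : forall n, (Cmod (l - l') <= Cmod (u n - l) + Cmod (u n - l'))%R).
  { intros n; replace (l - l') with (- (u n - l) + (u n - l')) by ring.
    rewrite <- (Cmod_opp (u n - l)); apply Cmod_triangle. }
  assert (Hle := is_lim_seq_le _ _ (Cmod (l - l')) _ Hn (is_lim_seq_const _) Hs).
  simpl in Hle.
  assert (E : l - l' = RtoC 0) by (apply Cmod_eq_0; generalize (Cmod_ge_0 (l - l')); lra).
  replace l with (l - l' + l') by ring; rewrite E; ring.
Qed.

Lemma Ctends_plus (u v : nat -> C) (l l' : C) :
  Ctends u l -> Ctends v l' -> Ctends (fun n => u n + v n) (l + l').
Proof.
  intros H H'.
  apply Ctends_squeeze with (fun n => Cmod (u n - l) + Cmod (v n - l'))%R.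
  - intros n; replace (u n + v n - (l + l')) with (u n - l + (v n - l')) by ring.
    apply Cmod_triangle.
  - replace (Finite 0) with (Finite (0 + 0)) by (f_equal; ring).
    apply is_lim_seq_plus'; assumption.
Qed.

Lemma Ctends_mult (u v : nat -> C) (l l' : C) :
  Ctends u l -> Ctends v l' -> Ctends (fun n => u n * v n) (l * l').
Proof.
  intros H H'.
  apply Ctends_squeeze with (fun n => Cmod (u n - l) * Cmod (v n - l')
    + (Cmod l * Cmod (v n - l') + Cmod l' * Cmod (u n - l)))%R.
  - intros n.
    replace (u n * v n - l * l')
      with ((u n - l) * (v n - l') + (l * (v n - l') + l' * (u n - l))) by ring.
    rewrite <- !Cmod_mult.
    eapply Rle_trans; [apply Cmod_triangle|].
    apply Rplus_le_compat_l, Cmod_triangle.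
  - replace (Finite 0) with (Finite (0 * 0 + (Cmod l * 0 + Cmod l' * 0)))
      by (f_equal; ring).
    apply is_lim_seq_plus'; [apply is_lim_seq_mult'; assumption|].
    apply is_lim_seq_plus'; apply is_lim_seq_mult';
      solve [assumption | apply is_lim_seq_const].
Qed.

Lemma Ctends_const (l : C) : Ctends (fun _ => l) l.
Proof.
  apply Ctends_squeeze with (fun _ => 0%R); [|apply is_lim_seq_const].
  intros _; replace (l - l) with (RtoC 0) by ring; rewrite Cmod_0; lra.
Qed.

Lemma Ctends_lower (u : nat -> C) (l : C) (d : R) :
  (forall n, (d <= Cmod (u n))%R) -> Ctends u l -> (d <= Cmod l)%R.
Proof.
  intros Hd H.
  assert (Hs : is_lim_seq (fun n => Cmod (u n - l) + Cmod l)%R (0 + Cmod l)%R)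
    by (apply is_lim_seq_plus'; [exact H|apply is_lim_seq_const]).
  assert (Hn : forall n, (d <= Cmod (u n - l) + Cmod l)%R).
  { intros n; apply (Rle_trans _ _ _ (Hd n)).
    replace (u n) with (u n - l + l) at 1 by ring; apply Cmod_triangle. }
  assert (Hle := is_lim_seq_le _ _ d _ Hn (is_lim_seq_const _) Hs).
  simpl in Hle; lra.
Qed.

Lemma Ctends_inv (u : nat -> C) (l : C) (d : R) :
  (0 < d)%R -> (forall n, (d <= Cmod (u n))%R) ->
  Ctends u l -> Ctends (fun n => / u n) (/ l).
Proof.
  intros Hd Hu H.
  assert (Hl := Ctends_lower u l d Hu H).
  apply Ctends_squeeze with (fun n => Cmod (u n - l) * (/ d * / d))%R.
  - intros n; specialize (Hu n).
    assert (Hun : u n <> 0) by (apply Cmod_gt_0; lra).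
    assert (Hln : l <> 0) by (apply Cmod_gt_0; lra).
    replace (/ u n - / l) with (- (u n - l) * (/ u n * / l)) by (field; auto).
    rewrite !Cmod_mult, Cmod_opp, !Cmod_inv by assumption.
    apply Rmult_le_compat_l; [apply Cmod_ge_0|].
    apply Rmult_le_compat; try (left; apply Rinv_0_lt_compat; lra);
      apply Rinv_le_contravar; lra.
  - replace (Finite 0) with (Finite (0 * (/ d * / d))) by (f_equal; ring).
    apply is_lim_seq_mult'; [exact H|apply is_lim_seq_const].
Qed.

Lemma one_minus_Cmod (z : C) : (1 - Cmod z <= Cmod (1 - z) <= 1 + Cmod z)%R.
Proof.
  split.
  - generalize (Cmod_triangle (1 - z) z).
    replace (1 - z + z) with (RtoC 1) by ring; rewrite Cmod_1; lra.
  - generalize (Cmod_triangle 1 (- z)); rewrite Cmod_opp, Cmod_1; intros H; exact H.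
Qed.

(** The partial sums of the geometric series. *)
Definition geom (r : R) (n : nat) : R := ((1 - r ^ n) / (1 - r))%R.

Lemma geom_S (r : R) (n : nat) : (r < 1)%R -> (geom r (S n) = geom r n + r ^ n)%R.
Proof. intros H; unfold geom; simpl; field; lra. Qed.

Lemma geom_bounds (r : R) (n : nat) :
  (0 <= r < 1)%R -> (0 <= geom r n <= / (1 - r))%R.
Proof.
  intros H; unfold geom, Rdiv.
  assert (H0 : (0 <= r ^ n)%R) by (apply pow_le; lra).
  assert (H1 : (r ^ n <= 1)%R) by (rewrite <- (pow1 n); apply pow_incr; lra).
  assert (H2 : (0 < / (1 - r))%R) by (apply Rinv_0_lt_compat; lra).
  split; [apply Rmult_le_pos; lra|].
  rewrite <- (Rmult_1_l (/ (1 - r))) at 2; apply Rmult_le_compat_r; lra.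
Qed.

(** Each factor is at most [exp (|x| |q|^j)], so the product is at most
    [exp (c / (1 - |q|))]. The bound depends on [c] only, which makes it uniform
    under [x |-> q^s x]. *)
Lemma qpoch_upper (q : C) (c : R) : (Cmod q < 1)%R ->
  exists E : R, (0 < E)%R /\
    forall x n, (Cmod x <= c)%R -> (Cmod (qpoch x q n) <= E)%R.
Proof.
  intros Hq.
  assert (Hq0 := Cmod_ge_0 q).
  exists (exp (c * / (1 - Cmod q))); split; [apply exp_pos|].
  intros x n Hx.
  assert (Hx0 := Cmod_ge_0 x).
  assert (Hg := geom_bounds (Cmod q) n (conj Hq0 Hq)).
  apply Rle_trans with (exp (Cmod x * geom (Cmod q) n)).
  - clear Hg; induction n as [|n IH].
    + simpl; rewrite Cmod_1; unfold geom, Rdiv; simpl.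
      rewrite Rminus_diag, Rmult_0_l, Rmult_0_r, exp_0; lra.
    + rewrite qpoch_S, Cmod_mult, geom_S, Rmult_plus_distr_l, exp_plus by exact Hq.
      apply Rmult_le_compat; try apply Cmod_ge_0; [exact IH|].
      eapply Rle_trans; [apply one_minus_Cmod|].
      rewrite Cmod_mult, Cmod_pow; apply exp_ineq1_le.
  - assert (Hle : (Cmod x * geom (Cmod q) n <= c * / (1 - Cmod q))%R)
      by (apply Rmult_le_compat; lra).
    destruct Hle as [Hlt|Heq]; [left; now apply exp_increasing|rewrite Heq; lra].
Qed.

(** Weierstrass' inequality: a product of factors [1 - u_j] is at least
    [1] minus the sum of the [u_j]. *)
Lemma qpoch_lower_small (q x : C) (n : nat) : (Cmod q < 1)%R ->
  (Cmod x * / (1 - Cmod q) <= / 2)%R -> (/ 2 <= Cmod (qpoch x q n))%R.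
Proof.
  intros Hq Hx.
  assert (Hq0 := Cmod_ge_0 q).
  assert (Hx0 := Cmod_ge_0 x).
  assert (Hb : forall n, (0 <= Cmod x * geom (Cmod q) n <= / 2)%R).
  { intros k; destruct (geom_bounds (Cmod q) k (conj Hq0 Hq)) as [Hg0 Hg1].
    split; [now apply Rmult_le_pos|].
    eapply Rle_trans; [|exact Hx]; now apply Rmult_le_compat_l. }
  enough (H : (1 - Cmod x * geom (Cmod q) n <= Cmod (qpoch x q n))%R)
    by (specialize (Hb n); lra).
  induction n as [|n IH].
  - simpl; rewrite Cmod_1; specialize (Hb 0%nat); lra.
  - rewrite qpoch_S, Cmod_mult.
    assert (H1 := proj1 (one_minus_Cmod (x * q ^ n))).
    rewrite Cmod_mult, Cmod_pow in H1.
    assert (HS := Hb (S n)); rewrite geom_S, Rmult_plus_distr_l in * by exact Hq.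
    specialize (Hb n).
    assert (H2 : (0 <= Cmod x * Cmod q ^ n)%R)
      by (apply Rmult_le_pos; [exact Hx0|apply pow_le, Hq0]).
    set (A := (Cmod x * geom (Cmod q) n)%R) in *.
    set (B := (Cmod x * Cmod q ^ n)%R) in *.
    apply Rle_trans with ((1 - A) * (1 - B))%R.
    + assert (0 <= A * B)%R by (apply Rmult_le_pos; lra). nra.
    + apply Rmult_le_compat; lra.
Qed.

Lemma is_lim_seq_Cmod_pow (q : C) : (Cmod q < 1)%R ->
  is_lim_seq (fun n => (Cmod q ^ n)%R) 0.
Proof.
  intros Hq; apply is_lim_seq_geom.
  rewrite Rabs_pos_eq by apply Cmod_ge_0; exact Hq.
Qed.

(** From some index [K] on the factors are covered by [qpoch_lower_small], and the
    first [K] contribute a nonzero constant; this bounds [(x)_n] from below.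
    Dividing [(x)_(s+n)] by the bounded [(x)_s] makes the bound uniform in the
    shift [s]. *)
Lemma qpoch_lower (q x : C) : (Cmod q < 1)%R -> regular x q ->
  exists d : R, (0 < d)%R /\
    forall s n, (d <= Cmod (qpoch (x * q ^ s) q n))%R.
Proof.
  intros Hq Hx.
  assert (Hq0 := Cmod_ge_0 q).
  assert (Hr : (0 < 1 - Cmod q)%R) by lra.
  destruct (qpoch_upper q (Cmod x) Hq) as [E [HE HEb]].
  assert (Hlim : is_lim_seq (fun n => Cmod x * / (1 - Cmod q) * Cmod q ^ n)%R
                   (Cmod x * / (1 - Cmod q) * 0)%R).
  { apply is_lim_seq_mult'; [apply is_lim_seq_const|].
    apply is_lim_seq_Cmod_pow, Hq. }
  rewrite Rmult_0_r in Hlim.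
  assert (H2 : (0 < / 2)%R) by lra.
  destruct (proj2 (is_lim_seq_spec _ _) Hlim (mkposreal _ H2)) as [K HK].
  specialize (HK K (Nat.le_refl K)); simpl in HK.
  rewrite Rminus_0_r in HK; apply Rabs_def2 in HK.
  assert (HP : (0 < Cmod (qpoch x q K))%R) by (apply Cmod_gt_0, qpoch_neq_0, Hx).
  exists (/ 2 * Cmod (qpoch x q K) / (E * E))%R; split.
  { apply Rdiv_lt_0_compat; apply Rmult_lt_0_compat; assumption || lra. }
  assert (Hlow : forall n, (/ 2 * Cmod (qpoch x q K) <= E * Cmod (qpoch x q n))%R).
  { intros n.
    assert (Hsplit : (/ 2 * Cmod (qpoch x q K) <= Cmod (qpoch x q (n + K)))%R).
    { rewrite Nat.add_comm, qpoch_add, Cmod_mult, Rmult_comm.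
      apply Rmult_le_compat_l; [lra|].
      apply qpoch_lower_small; [exact Hq|].
      rewrite Cmod_mult, Cmod_pow; lra. }
    eapply Rle_trans; [exact Hsplit|].
    rewrite qpoch_add, Cmod_mult, Rmult_comm.
    apply Rmult_le_compat_r; [apply Cmod_ge_0|].
    apply HEb; rewrite Cmod_mult, Cmod_pow.
    rewrite <- (Rmult_1_r (Cmod x)) at 2.
    apply Rmult_le_compat_l; [apply Cmod_ge_0|].
    rewrite <- (pow1 n); apply pow_incr; lra. }
  intros s n.
  specialize (Hlow (s + n)%nat).
  rewrite qpoch_add, Cmod_mult in Hlow.
  assert (Hs : (Cmod (qpoch x q s) <= E)%R) by (apply HEb; lra).
  apply Rle_div_l; [now apply Rmult_lt_0_compat|].
  eapply Rle_trans; [exact Hlow|].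
  assert (H0 := Cmod_ge_0 (qpoch (x * q ^ s) q n)).
  rewrite <- Rmult_assoc, (Rmult_comm _ (E * E)).
  apply Rmult_le_compat_r; [exact H0|].
  apply Rmult_le_compat_l; lra.
Qed.

Lemma qpoch_lower_unshifted (q x : C) : (Cmod q < 1)%R -> regular x q ->
  exists d : R, (0 < d)%R /\ forall n, (d <= Cmod (qpoch x q n))%R.
Proof.
  intros Hq Hx; destruct (qpoch_lower q x Hq Hx) as [d [Hd Hdb]].
  exists d; split; [exact Hd|intros n].
  specialize (Hdb 0%nat n); simpl in Hdb; now rewrite Cmult_1_r in Hdb.
Qed.

(** The increments [- (x)_n x q^n] are absolutely summable. *)
Lemma qpoch_inf_tends (x q : C) :
  (Cmod q < 1)%R -> Ctends (qpoch x q) (qpoch_inf x q).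
Proof.
  intros Hq.
  destruct (qpoch_upper q (Cmod x) Hq) as [E [HE HEb]].
  assert (Hex : ex_series (fun n => E * Cmod x * Cmod q ^ n)%R).
  { apply (@ex_series_scal R_AbsRing R_NormedModule (E * Cmod x)%R (fun n => Cmod q ^ n)%R).
    apply ex_series_geom; rewrite Rabs_pos_eq by apply Cmod_ge_0; exact Hq. }
  assert (Hle : forall n,
    (Cmod (- (qpoch x q n * (x * q ^ n))) <= E * Cmod x * Cmod q ^ n)%R).
  { intros n; rewrite Cmod_opp, !Cmod_mult, Cmod_pow, <- Rmult_assoc.
    apply Rmult_le_compat_r; [apply pow_le, Cmod_ge_0|].
    apply Rmult_le_compat_r; [apply Cmod_ge_0|].
    apply HEb, Rle_refl. }
  destruct (@ex_series_le C_AbsRing C_CompleteNormedModule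
    (fun n => - (qpoch x q n * (x * q ^ n))) _ Hle Hex) as [L HL].
  assert (Ht : Ctends (qpoch x q) (1 + L)).
  { apply is_lim_seq_incr_1.
    apply Ctends_filterlim in HL.
    apply (Ctends_ext
      (fun n => 1 + sum_n (fun n => - (qpoch x q n * (x * q ^ n))) n)).
    - intros n; induction n as [|n IH].
      + rewrite C_sum_O; simpl; ring.
      + rewrite C_sum_Sn, Cplus_assoc, IH, (qpoch_S x q (S n)); ring.
    - apply Ctends_plus; [apply Ctends_const|exact HL]. }
  rewrite (qpoch_inf_unique x q (1 + L)); [exact Ht|].
  apply Ctends_filterlim, Ht.
Qed.

Lemma qpoch_inf_S (x q : C) :
  (Cmod q < 1)%R -> qpoch_inf x q = (1 - x) * qpoch_inf (q * x) q.
Proof.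
  intros Hq; apply (Ctends_unique (fun n => qpoch x q (S n))).
  - apply (is_lim_seq_incr_1 (fun n => Cmod (qpoch x q n - qpoch_inf x q))).
    apply qpoch_inf_tends, Hq.
  - apply (Ctends_ext (fun n => (1 - x) * qpoch (q * x) q n)).
    + intros n; symmetry; apply qpoch_S_l.
    + apply Ctends_mult; [apply Ctends_const|apply qpoch_inf_tends, Hq].
Qed.

Lemma qpoch_inv_tends (x q : C) : (Cmod q < 1)%R -> regular x q ->
  Ctends (fun n => / qpoch x q n) (/ qpoch_inf x q).
Proof.
  intros Hq Hx.
  destruct (qpoch_lower_unshifted q x Hq Hx) as [d [Hd Hdb]].
  apply (Ctends_inv _ _ d Hd); [exact Hdb|apply qpoch_inf_tends, Hq].
Qed.

(** A limit of products bounded away from [0]. *)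
Lemma qpoch_inf_neq_0 (x q : C) : (Cmod q < 1)%R -> regular x q -> qpoch_inf x q <> 0.
Proof.
  intros Hq Hx.
  destruct (qpoch_lower_unshifted q x Hq Hx) as [d [Hd Hdb]].
  apply Cmod_gt_0, (Rlt_le_trans _ _ _ Hd).
  apply (Ctends_lower (qpoch x q)); [exact Hdb|apply qpoch_inf_tends, Hq].
Qed.

(** * The sum for the constant polynomial *)
Lemma regular_mul_pow (x q : C) (s : nat) : regular x q -> regular (x * q ^ s) q.
Proof.
  intros H k E; apply (H (s + k)%nat); rewrite <- E, Cpow_add_r; ring.
Qed.

Lemma Cmod_mul_pow_le (q x : C) (n : nat) :
  (Cmod q < 1)%R -> (Cmod (x * q ^ n) <= Cmod x)%R.
Proof.
  intros Hq; rewrite Cmod_mult, Cmod_pow, <- Rmult_1_r.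
  apply Rmult_le_compat_l; [apply Cmod_ge_0|].
  rewrite <- (pow1 n); apply pow_incr; split; [apply Cmod_ge_0|lra].
Qed.

Lemma Cmod_div_le (x y : C) (c d : R) :
  (0 < d)%R -> (Cmod x <= c)%R -> (d <= Cmod y)%R -> (Cmod (x / y) <= c / d)%R.
Proof.
  intros Hd Hx Hy.
  rewrite Cmod_div by (apply Cmod_gt_0; lra).
  apply Rmult_le_compat; [apply Cmod_ge_0| |exact Hx|].
  - left; apply Rinv_0_lt_compat; lra.
  - apply Rinv_le_contravar; assumption.
Qed.

Lemma Cmod_mult_le (x y : C) (c d : R) :
  (Cmod x <= c)%R -> (Cmod y <= d)%R -> (Cmod (x * y) <= c * d)%R.
Proof.
  intros Hx Hy; rewrite Cmod_mult.
  apply Rmult_le_compat; try apply Cmod_ge_0; assumption.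
Qed.

Lemma vwp_coef_bound (q : C) (c : R) : (Cmod q < 1)%R ->
  exists M : R, forall A n, (Cmod A <= c)%R -> (Cmod (vwp_coef A q n) <= M)%R.
Proof.
  intros Hq.
  destruct (qpoch_upper q c Hq) as [E [HE HEb]].
  destruct (qpoch_lower_unshifted q q Hq (regular_base q Hq)) as [d [Hd Hdb]].
  exists (Rmax 1 (E * (1 + c) / d)); intros A n HA.
  destruct n as [|k].
  - simpl; rewrite Cmod_1; apply Rmax_l.
  - eapply Rle_trans; [|apply Rmax_r].
    assert (HqA : (Cmod (q * A) <= c)%R).
    { rewrite Cmult_comm, <- (Cpow_1_r q).
      eapply Rle_trans; [apply Cmod_mul_pow_le, Hq|exact HA]. }
    apply Cmod_div_le; [exact Hd| |].
    + apply Cmod_mult_le; [apply HEb, HqA|].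
      eapply Rle_trans; [apply one_minus_Cmod|].
      apply Rplus_le_compat_l.
      eapply Rle_trans; [apply Cmod_mul_pow_le, Hq|exact HA].
    + apply Hdb.
Qed.

Lemma qfall_bound (q t : C) (n : nat) :
  (Cmod q < 1)%R -> (Cmod (qfall t 1 q n) <= (Cmod t + 1) ^ n)%R.
Proof.
  intros Hq; induction n as [|n IH].
  - simpl; rewrite Cmod_1; lra.
  - rewrite qfall_S; simpl; rewrite Rmult_comm.
    apply Cmod_mult_le; [exact IH|].
    eapply Rle_trans; [apply (Cmod_triangle t (- (1 * q ^ n)))|].
    apply Rplus_le_compat_l; rewrite Cmod_opp.
    eapply Rle_trans; [apply Cmod_mul_pow_le, Hq|].
    rewrite Cmod_1; lra.
Qed.

(** Up to a constant, a bound for the [n]-th term; the Gaussian decay of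
    [qfall 0 (q * a) q n] beats the exponential factor. *)
Definition majorant (q a t : C) (n : nat) : R :=
  (Cmod (qfall 0 (q * a) q n) * (Cmod t + 1) ^ n)%R.

Lemma majorant_pos (q a t : C) (n : nat) : q <> 0 -> a <> 0 -> (0 < majorant q a t n)%R.
Proof.
  intros Hq Ha; apply Rmult_lt_0_compat.
  - apply Cmod_gt_0; induction n as [|n IH]; [exact C1_nz|].
    rewrite qfall_S; apply Cmult_neq_0; [exact IH|].
    replace (0 - q * a * q ^ n) with (- (1) * (q * a * q ^ n)) by ring.
    repeat apply Cmult_neq_0; try assumption; [|now apply Cpow_nz].
    intros E; apply C1_nz; replace (RtoC 1) with (- - (1)) by ring; rewrite E; ring.
  - apply pow_lt; generalize (Cmod_ge_0 t); lra.
Qed.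

Lemma ex_series_majorant (q a t : C) :
  q <> 0 -> (Cmod q < 1)%R -> a <> 0 -> ex_series (majorant q a t).
Proof.
  intros Hq Hq1 Ha.
  assert (Hpos := fun n => majorant_pos q a t n Hq Ha).
  apply (ex_series_ext (fun n => Rabs (majorant q a t n)));
    [intros n; apply Rabs_pos_eq, Rlt_le, Hpos|].
  apply ex_series_DAlembert with 0%R; [lra|intros n; apply Rgt_not_eq, Hpos|].
  apply (is_lim_seq_ext
    (fun n => Cmod (q * a) * (Cmod t + 1) * Cmod q ^ n)%R).
  - intros n; rewrite Rabs_pos_eq by (apply Rlt_le, Rdiv_lt_0_compat; apply Hpos).
    specialize (Hpos n); unfold majorant in *.
    rewrite qfall_S.
    replace (0 - q * a * q ^ n) with (- (q * a * q ^ n)) by ring.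
    rewrite !Cmod_mult, Cmod_opp, !Cmod_mult, Cmod_pow; simpl.
    set (x := Cmod (qfall _ _ _ _)) in *; set (y := ((Cmod t + 1) ^ n)%R) in *.
    assert (Hx : (x <> 0)%R) by (intros E; rewrite E in Hpos; lra).
    assert (Hy : (y <> 0)%R) by (intros E; rewrite E in Hpos; lra).
    field; split; assumption.
  - replace (Finite 0) with (Finite (Cmod (q * a) * (Cmod t + 1) * 0))
      by (f_equal; ring).
    apply is_lim_seq_mult'; [apply is_lim_seq_const|apply is_lim_seq_Cmod_pow, Hq1].
Qed.

(** Replacing [a] by [q^s a] affects the size of the [n]-th term only through
    [[0, q a]_n], which is multiplied by [q^(s n)]; all the other factors are
    bounded uniformly in [s]. *)
Lemma vwp_term_bound (q a b t : C) :
  (Cmod q < 1)%R -> regular (q * a) q -> regular (q ^ 2 * a * b * t) q ->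
  exists M : R, forall s n,
    (Cmod (vwp_term q (q ^ s * a) b t n)
     <= M * ((Cmod q ^ s) ^ n * majorant q a t n))%R.
Proof.
  intros Hq Ha Ht.
  destruct (vwp_coef_bound q (Cmod (q * a * b)) Hq) as [M1 HM1].
  destruct (qpoch_upper q (Cmod (q * b)) Hq) as [E [_ HE]].
  destruct (qpoch_lower q _ Hq Ha) as [d [Hd Hdb]].
  destruct (qpoch_lower q _ Hq Ht) as [e [He Heb]].
  exists (M1 / e * (E / d))%R; intros s n.
  unfold vwp_term, kernel, majorant.
  replace (q * (q ^ s * a) * b) with (q * a * b * q ^ s) by ring.
  replace (q ^ 2 * (q ^ s * a) * b * t) with (q ^ 2 * a * b * t * q ^ s) by ring.
  replace (qfall 0 (q * (q ^ s * a)) q n)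
    with ((q ^ s) ^ n * qfall 0 (q * a) q n)
    by (rewrite <- qfall_scale; f_equal; ring).
  replace (q * (q ^ s * a)) with (q * a * q ^ s) by ring.
  replace (M1 / e * (E / d) * ((Cmod q ^ s) ^ n
            * (Cmod (qfall 0 (q * a) q n) * (Cmod t + 1) ^ n)))%R
    with ((M1 * (Cmod t + 1) ^ n) / e
          * (((Cmod q ^ s) ^ n * Cmod (qfall 0 (q * a) q n)) * E / d))%R
    by (unfold Rdiv; ring).
  apply Cmod_mult_le; apply Cmod_div_le; auto; apply Cmod_mult_le.
  - apply HM1, Cmod_mul_pow_le, Hq.
  - apply qfall_bound, Hq.
  - rewrite Cmod_mult, !Cmod_pow; apply Rle_refl.
  - apply HE, Rle_refl.
Qed.

Lemma vwp_boundary_tends (q a b t : C) :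
  q <> 0 -> (Cmod q < 1)%R -> a <> 0 ->
  regular (q * a) q -> regular (q ^ 2 * a * b * t) q ->
  Ctends (vwp_boundary q a b t) 0.
Proof.
  intros Hq Hq1 Ha0 Ha Ht.
  destruct (qpoch_upper q (Cmod (q * (q * a * b))) Hq1) as [E1 [HE1' HE1]].
  destruct (qpoch_upper q (Cmod (q * b)) Hq1) as [E2 [_ HE2]].
  destruct (qpoch_lower_unshifted q _ Hq1 (regular_base q Hq1)) as [d1 [Hd1 Hb1]].
  destruct (qpoch_lower_unshifted q _ Hq1 (regular_shift _ _ Ht)) as [d2 [Hd2 Hb2]].
  destruct (qpoch_lower_unshifted q _ Hq1 (regular_shift _ _ Ha)) as [d3 [Hd3 Hb3]].
  apply Ctends_squeeze
    with (fun n => E1 * E2 / (d1 * d2 * d3) * majorant q a t (S n))%R.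
  - intros n; replace (vwp_boundary q a b t n - 0) with (vwp_boundary q a b t n) by ring.
    unfold vwp_boundary, majorant.
    specialize (Hb1 n); specialize (Hb2 n); specialize (Hb3 n).
    replace (E1 * E2 / (d1 * d2 * d3) * (Cmod (qfall 0 (q * a) q (S n))
                                 * (Cmod t + 1) ^ S n))%R
      with (E1 * (Cmod t + 1) ^ S n * E2 * Cmod (qfall 0 (q * a) q (S n))
            / (d1 * d2 * d3))%R by (unfold Rdiv; ring).
    apply Cmod_div_le.
    + repeat apply Rmult_lt_0_compat; assumption.
    + rewrite Cmod_opp; apply Cmod_mult_le; [|apply Rle_refl].
      apply Cmod_mult_le; [apply Cmod_mult_le|].
      * apply HE1, Rle_refl.
      * apply qfall_bound, Hq1.
      * apply HE2, Rle_refl.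
    + rewrite !Cmod_mult.
      apply Rmult_le_compat; [| |apply Rmult_le_compat|exact Hb3]; try lra.
      apply Rmult_le_pos; lra.
  - replace (Finite 0) with (Finite (E1 * E2 / (d1 * d2 * d3) * 0)) by (f_equal; ring).
    apply is_lim_seq_mult'; [apply is_lim_seq_const|].
    apply -> is_lim_seq_incr_1.
    apply ex_series_lim_0, ex_series_majorant; assumption.
Qed.

Definition vwp_ratio (q a b t : C) (s : nat) : C :=
  qpoch (q * (q * a * b)) q s * qpoch (q * a * t) q s
  * (/ qpoch (q * a) q s * / qpoch (q ^ 2 * a * b * t) q s).

(** [vwp_telescope] applied [s] times, at [a], [q a], ..., [q^(s-1) a]. *)
Lemma vwp_iterate (q a b t : C) (s : nat) :
  q <> 0 -> (Cmod q < 1)%R -> a <> 0 ->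
  regular (q * a) q -> regular (q ^ 2 * a * b * t) q ->
  Ctends (fun N => sum_n (vwp_term q a b t) N
                   - vwp_ratio q a b t s * sum_n (vwp_term q (q ^ s * a) b t) N) 0.
Proof.
  intros Hq Hq1 Ha0 Ha Ht.
  induction s as [|s IH].
  - apply (Ctends_ext (fun _ => 0)); [|apply Ctends_const].
    intros N; unfold vwp_ratio; simpl.
    replace (1 * a) with a by ring; field.
  - set (a' := q ^ s * a) in *.
    assert (Ha' : regular (q * a') q).
    { replace (q * a') with (q * a * q ^ s) by (unfold a'; ring).
      now apply regular_mul_pow. }
    assert (Ht' : regular (q ^ 2 * a' * b * t) q).
    { replace (q ^ 2 * a' * b * t) with (q ^ 2 * a * b * t * q ^ s) by (unfold a'; ring).
      now apply regular_mul_pow. }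
    assert (Ha0' : a' <> 0) by (apply Cmult_neq_0; [now apply Cpow_nz|assumption]).
    assert (H1 := regular_head _ _ Ha').
    assert (H2 := regular_head _ _ Ht').
    assert (H3 := qpoch_neq_0 _ _ s Ha).
    assert (H4 := qpoch_neq_0 _ _ s Ht).
    set (c := vwp_ratio q a b t s / ((1 - q * a') * (1 - q ^ 2 * a' * b * t))).
    apply (Ctends_ext (fun N => (sum_n (vwp_term q a b t) N
        - vwp_ratio q a b t s * sum_n (vwp_term q a' b t) N)
        + c * vwp_boundary q a' b t N)).
    + intros N.
      assert (HT := vwp_telescope q a' b t N (regular_base q Hq1) Ha' Ht').
      replace (q ^ S s * a) with (q * a') by (unfold a'; rewrite Cpow_S; ring).
      assert (Hb : vwp_boundary q a' b t N
        = (1 - q * a') * (1 - q ^ 2 * a' * b * t) * sum_n (vwp_term q a' b t) N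
          - (1 - q * (q * a' * b)) * (1 - q * a' * t) * sum_n (vwp_term q (q * a') b t) N)
        by (rewrite HT; ring).
      rewrite Hb.
      unfold c, vwp_ratio; rewrite !qpoch_S.
      replace (1 - q * (q * a * b) * q ^ s) with (1 - q * (q * a' * b))
        by (unfold a'; ring).
      replace (1 - q * a * t * q ^ s) with (1 - q * a' * t) by (unfold a'; ring).
      replace (1 - q * a * q ^ s) with (1 - q * a') by (unfold a'; ring).
      replace (1 - q ^ 2 * a * b * t * q ^ s) with (1 - q ^ 2 * a' * b * t)
        by (unfold a'; ring).
      generalize (sum_n (vwp_term q a b t) N : C); intros S0.
      generalize (sum_n (vwp_term q a' b t) N : C); intros S1.
      generalize (sum_n (vwp_term q (q * a') b t) N : C); intros S2.
      field; repeat split; assumption.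
    + replace (RtoC 0) with (0 + c * 0) by ring.
      apply Ctends_plus; [exact IH|].
      apply Ctends_mult; [apply Ctends_const|].
      now apply vwp_boundary_tends.
Qed.

Lemma vwp_term_0 (q a b t : C) : vwp_term q a b t 0 = 1.
Proof. unfold vwp_term, kernel; simpl; field. Qed.

(** Every term but the first carries the factor [|q|^(s n)], at most [|q|^s], and
    the first is [1]. *)
Lemma vwp_sum_near_1 (q a b t : C) :
  q <> 0 -> (Cmod q < 1)%R -> a <> 0 ->
  regular (q * a) q -> regular (q ^ 2 * a * b * t) q ->
  exists K : R, forall s N,
    (Cmod (sum_n (vwp_term q (q ^ s * a) b t) N - 1) <= K * Cmod q ^ s)%R.
Proof.
  intros Hq Hq1 Ha0 Ha Ht.
  destruct (vwp_term_bound q a b t Hq1 Ha Ht) as [M HM].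
  assert (Hq0 := Cmod_ge_0 q).
  assert (Hpos := fun n => majorant_pos q a t n Hq Ha0).
  assert (HM0 : (0 <= M)%R).
  { specialize (HM 0%nat 0%nat); specialize (Hpos 0%nat); simpl in HM.
    rewrite Rmult_1_l in HM.
    generalize (Rle_trans _ _ _ (Cmod_ge_0 _) HM); intros H0.
    apply Rmult_le_reg_r with (majorant q a t 0); lra. }
  destruct (ex_series_majorant q a t Hq Hq1 Ha0) as [B HB].
  exists (M * B)%R; intros s N.
  assert (Hs : (0 <= Cmod q ^ s <= 1)%R).
  { split; [now apply pow_le|rewrite <- (pow1 s); apply pow_incr; lra]. }
  apply Rle_trans with (M * sum_n (majorant q a t) N * Cmod q ^ s)%R.
  - induction N as [|N IH].
    + rewrite C_sum_O, vwp_term_0.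
      replace (1 - 1) with (RtoC 0) by ring; rewrite Cmod_0, sum_O.
      specialize (Hpos 0%nat).
      apply Rmult_le_pos; [apply Rmult_le_pos; lra|lra].
    + rewrite C_sum_Sn, sum_Sn.
      set (x := vwp_term _ _ _ _ _); set (S0 := sum_n _ N) in IH |- *.
      replace (S0 + x - 1) with (S0 - 1 + x) by ring.
      eapply Rle_trans; [apply Cmod_triangle|].
      change plus with Rplus.
      rewrite Rmult_plus_distr_l, Rmult_plus_distr_r.
      apply Rplus_le_compat; [exact IH|].
      eapply Rle_trans; [apply HM|].
      rewrite Rmult_assoc; apply Rmult_le_compat_l; [exact HM0|].
      rewrite Rmult_comm; apply Rmult_le_compat_l; [apply Rlt_le, Hpos|].
      rewrite <- tech_pow_Rmult; set (r := (Cmod q ^ s)%R) in *.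
      rewrite <- (Rmult_1_r r) at 3; apply Rmult_le_compat_l; [lra|].
      rewrite <- (pow1 N); apply pow_incr; lra.
  - apply Rmult_le_compat_r; [lra|]; apply Rmult_le_compat_l; [exact HM0|].
    apply (is_lim_seq_incr_compare (sum_n (majorant q a t)) B).
    + exact HB.
    + intros n; rewrite sum_Sn; change plus with Rplus.
      specialize (Hpos (S n)); lra.
Qed.

(** First choose [s] so that [d s] is small, then [n] for that [s]. *)
Lemma Ctends_diagonal (u : nat -> C) (l : C) (e : nat -> nat -> R) (d : nat -> R) :
  (forall s n, (Cmod (u n - l) <= e s n + d s)%R) ->
  (forall s, is_lim_seq (e s) 0) -> is_lim_seq d 0 -> Ctends u l.
Proof.
  intros H He Hd; apply is_lim_seq_spec; intros eps.
  assert (Heps : (0 < eps / 2)%R) by (generalize (cond_pos eps); lra).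
  destruct (proj2 (is_lim_seq_spec _ _) Hd (mkposreal _ Heps)) as [s Hs].
  destruct (proj2 (is_lim_seq_spec _ _) (He s) (mkposreal _ Heps)) as [N HN].
  exists N; intros n Hn.
  specialize (Hs s (Nat.le_refl s)); specialize (HN n Hn); simpl in Hs, HN.
  rewrite Rminus_0_r in *.
  apply Rabs_def2 in Hs; apply Rabs_def2 in HN.
  rewrite Rabs_pos_eq by apply Cmod_ge_0.
  specialize (H s n); lra.
Qed.

Definition vwp_value (q a b t : C) : C :=
  qpoch_inf (q ^ 2 * a * b) q * qpoch_inf (q * a * t) q
  / (qpoch_inf (q * a) q * qpoch_inf (q ^ 2 * a * b * t) q).

Lemma vwp_ratio_tends (q a b t : C) :
  (Cmod q < 1)%R -> regular (q * a) q -> regular (q ^ 2 * a * b * t) q ->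
  Ctends (vwp_ratio q a b t) (vwp_value q a b t).
Proof.
  intros Hq Ha Ht.
  replace (vwp_value q a b t)
    with (qpoch_inf (q * (q * a * b)) q * qpoch_inf (q * a * t) q
          * (/ qpoch_inf (q * a) q * / qpoch_inf (q ^ 2 * a * b * t) q)).
  - repeat apply Ctends_mult; solve [now apply qpoch_inf_tends | now apply qpoch_inv_tends].
  - unfold vwp_value; replace (q * (q * a * b)) with (q ^ 2 * a * b) by ring.
    assert (H1 := qpoch_inf_neq_0 _ _ Hq Ha).
    assert (H2 := qpoch_inf_neq_0 _ _ Hq Ht).
    field; split; assumption.
Qed.

(** The partial sum [P_N(a)] is close to [R_s P_N(q^s a)] for large [N], hence to
    [R_s] for large [s], with [R_s] the accumulated ratio; and [R_s] tends to the
    quotient of infinite products. *)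
Lemma vwp_series (q a b t : C) :
  q <> 0 -> (Cmod q < 1)%R -> a <> 0 ->
  regular (q * a) q -> regular (q ^ 2 * a * b * t) q ->
  @is_series C_AbsRing C_NormedModule (vwp_term q a b t) (vwp_value q a b t).
Proof.
  intros Hq Hq1 Ha0 Ha Ht.
  destruct (vwp_sum_near_1 q a b t Hq Hq1 Ha0 Ha Ht) as [K HK].
  assert (HR := vwp_ratio_tends q a b t Hq1 Ha Ht).
  set (V := vwp_value q a b t) in *.
  set (R_ := vwp_ratio q a b t) in *.
  apply Ctends_is_series, Ctends_diagonal with
    (e := fun s N => Cmod (sum_n (vwp_term q a b t) N
            - R_ s * sum_n (vwp_term q (q ^ s * a) b t) N - 0))
    (d := fun s => ((Cmod (R_ s - V) + Cmod V) * (K * Cmod q ^ s)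
                    + Cmod (R_ s - V))%R).
  - intros s N.
    specialize (HK s N).
    set (S0 := sum_n (vwp_term q a b t) N : C).
    set (S1 := sum_n (vwp_term q (q ^ s * a) b t) N : C) in *.
    replace (S0 - V) with ((S0 - R_ s * S1 - 0) + (R_ s * (S1 - 1) + (R_ s - V))) by ring.
    eapply Rle_trans; [apply Cmod_triangle|apply Rplus_le_compat_l].
    eapply Rle_trans; [apply Cmod_triangle|apply Rplus_le_compat_r].
    apply Cmod_mult_le; [|exact HK].
    replace (R_ s) with (R_ s - V + V) at 1 by ring; apply Cmod_triangle.
  - intros s; now apply vwp_iterate.
  - replace (Finite 0) with (Finite ((0 + Cmod V) * (K * 0) + 0)) by (f_equal; ring).
    apply is_lim_seq_plus'; [apply is_lim_seq_mult'|exact HR].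
    + apply is_lim_seq_plus'; [exact HR|apply is_lim_seq_const].
    + apply is_lim_seq_mult'; [apply is_lim_seq_const|].
      apply is_lim_seq_Cmod_pow, Hq1.
Qed.

(** * From the constant polynomial to the monomials *)
Definition expands (q a b t : C) (f : C -> C) : Prop :=
  @is_series C_AbsRing C_NormedModule
    (fun n => kernel q a b t n * jacobi_sum f n a b q) (vwp_value q a b t * f t).

Lemma vwp_value_shift (q a b t : C) :
  q <> 0 -> (Cmod q < 1)%R ->
  regular (q * a) q -> regular (q ^ 2 * a * b * t) q ->
  vwp_value q a b t = shift_factor q a b t * vwp_value q (q * a) (q * b) (t / q).
Proof.
  intros Hq Hq1 Ha Ht; unfold vwp_value, shift_factor.
  replace (q * (q * a) * (t / q)) with (q * a * t) by (field; exact Hq).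
  replace (q ^ 2 * (q * a) * (q * b) * (t / q)) with (q * (q ^ 2 * a * b * t))
    by (field; exact Hq).
  replace (q ^ 2 * (q * a) * (q * b)) with (q * (q * (q * (q * a * b)))) by ring.
  replace (qpoch_inf (q ^ 2 * a * b) q) with (qpoch_inf (q * (q * a * b)) q)
    by (f_equal; ring).
  rewrite (qpoch_inf_S (q * (q * a * b))), (qpoch_inf_S (q * (q * (q * a * b)))),
    (qpoch_inf_S (q * a)), (qpoch_inf_S (q ^ 2 * a * b * t)) by exact Hq1.
  assert (H1 := qpoch_inf_neq_0 _ _ Hq1 (regular_shift _ _ Ha)).
  assert (H2 := qpoch_inf_neq_0 _ _ Hq1 (regular_shift _ _ Ht)).
  assert (H3 := regular_head _ _ Ha).
  assert (H4 := regular_head _ _ Ht).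
  field; repeat split; assumption.
Qed.

(** Induction on [j] over all parameters at once: the term [n = 0] vanishes because
    [[1, 1]_(j+1) = 0], and the others are a multiple of the series for [j] at
    [(q a, q b, t/q)]. *)
Lemma expands_qfall (q : C) (j : nat) (a b t : C) :
  q <> 0 -> (Cmod q < 1)%R -> a <> 0 ->
  regular (q * a) q -> regular (q ^ 2 * a * b * t) q ->
  expands q a b t (fun x => qfall x 1 q j).
Proof.
  intros Hq Hq1; assert (Hqq := regular_base q Hq1).
  revert a b t; induction j as [|j IH]; intros a b t Ha0 Ha Ht; unfold expands.
  - simpl; rewrite Cmult_1_r.
    apply (is_series_ext (vwp_term q a b t)); [|now apply vwp_series].
    intros n; rewrite jacobi_sum_1 by assumption; reflexivity.
  - apply is_series_decr_1.
    assert (Ht' : regular (q ^ 2 * (q * a) * (q * b) * (t / q)) q).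
    { replace (q ^ 2 * (q * a) * (q * b) * (t / q)) with (q * (q ^ 2 * a * b * t))
        by (field; exact Hq).
      now apply regular_shift. }
    specialize (IH (q * a) (q * b) (t / q) (Cmult_neq_0 _ _ Hq Ha0)
                  (regular_shift _ _ Ha) Ht').
    apply (is_series_scal ((t - 1) * q ^ j * shift_factor q a b t)) in IH.
    match type of IH with is_series _ ?x => match goal with |- is_series _ ?y =>
      replace y with x end end.
    + eapply is_series_ext; [|exact IH].
      intros n; symmetry; now apply kernel_jacobi_sum_shift.
    + change (((t - 1) * q ^ j * shift_factor q a b t)
        * (vwp_value q (q * a) (q * b) (t / q) * qfall (t / q) 1 q j)
        = vwp_value q a b t * qfall t 1 q (S j)
          - kernel q a b t 0 * jacobi_sum (fun x => qfall x 1 q (S j)) 0 a b q).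
      unfold jacobi_sum; rewrite C_sum_O.
      rewrite (vwp_value_shift q a b t) by assumption.
      rewrite !qfall_S_l.
      replace (qfall t (q * 1) q j) with (q ^ j * qfall (t / q) 1 q j)
        by (rewrite <- qfall_scale; f_equal; field; exact Hq).
      simpl (q ^ 0); ring.
Qed.

(** The extra factor [[X, 1]_j] is what makes the induction on [m] close:
    [X [X, 1]_j = [X, 1]_(j+1) + q^j [X, 1]_j] trades a power for either basis
    element. *)
Lemma expands_pow_qfall (q : C) (m j : nat) (a b t : C) :
  q <> 0 -> (Cmod q < 1)%R -> a <> 0 ->
  regular (q * a) q -> regular (q ^ 2 * a * b * t) q ->
  expands q a b t (fun x => x ^ m * qfall x 1 q j).
Proof.
  intros Hq Hq1 Ha0 Ha Ht; revert j; induction m as [|m IH]; intros j.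
  - generalize (expands_qfall q j a b t Hq Hq1 Ha0 Ha Ht); unfold expands.
    simpl (t ^ 0); rewrite Cmult_1_l; apply is_series_ext; intros n.
    apply f_equal, C_sum_ext; intros k _; simpl ((q ^ k) ^ 0); ring.
  - assert (H := is_series_plus _ _ _ _ (IH (S j)) (is_series_scal (q ^ j) _ _ (IH j))).
    unfold expands.
    match type of H with is_series _ ?x => match goal with |- is_series _ ?y =>
      replace y with x end end.
    + eapply is_series_ext; [|exact H]; intros n.
      change (kernel q a b t n * jacobi_sum (fun x => x ^ m * qfall x 1 q (S j)) n a b q
        + q ^ j * (kernel q a b t n * jacobi_sum (fun x => x ^ m * qfall x 1 q j) n a b q)
        = kernel q a b t n
          * jacobi_sum (fun x => x ^ S m * qfall x 1 q j) n a b q).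
      rewrite Cmult_assoc, (Cmult_comm (q ^ j)), <- Cmult_assoc, <- Cmult_plus_distr_l.
      unfold jacobi_sum; rewrite <- C_sum_scal, <- C_sum_plus.
      apply f_equal, C_sum_ext; intros k _.
      rewrite qfall_S, (Cpow_S (q ^ k)); unfold Cdiv; ring.
    + change (vwp_value q a b t * (t ^ m * qfall t 1 q (S j))
        + q ^ j * (vwp_value q a b t * (t ^ m * qfall t 1 q j))
        = vwp_value q a b t * (t ^ S m * qfall t 1 q j)).
      rewrite qfall_S, Cpow_S; ring.
Qed.

(** Since [(w, -w; q)_n] is [(w^2; q^2)_n], the quotient of the products
    telescopes; only the squares of [w] and [v] matter. *)
Lemma qpoch_sqrt_quotient (q c w v : C) (n : nat) :
  w ^ 2 = c -> v ^ 2 = q ^ 2 * c ->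
  (1 - c) * (qpoch v q n * qpoch (- v) q n)
  = qpoch w q n * qpoch (- w) q n * (1 - c * q ^ (2 * n)).
Proof.
  intros Hw Hv.
  assert (Hq2 : forall k, q ^ (2 * k) = q ^ k * q ^ k)
    by (intros k; rewrite <- Cpow_add_r; f_equal; lia).
  induction n as [|n IH].
  - simpl; ring.
  - rewrite !qpoch_S.
    transitivity ((1 - c) * (qpoch v q n * qpoch (- v) q n)
                  * (1 - v ^ 2 * (q ^ n * q ^ n))); [ring|].
    rewrite IH, Hv, !Hq2, (Cpow_S q n).
    transitivity (qpoch w q n * qpoch (- w) q n * (1 - w ^ 2 * (q ^ n * q ^ n))
      * (1 - q ^ 2 * c * (q ^ n * q ^ n))); [rewrite Hw|]; ring.
Qed.

Lemma regular_of_neq (x q : C) :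
  q <> 0 -> (forall k, x <> / q ^ k) -> regular x q.
Proof.
  intros Hq H k E; apply (H k).
  assert (Hk : q ^ k <> 0) by now apply Cpow_nz.
  replace x with (x * q ^ k / q ^ k) by (field; exact Hk); rewrite E; field; exact Hk.
Qed.

(* [w] and [v] are arbitrary square roots of $qab$ and $q^3ab$. *)
Theorem theorem8p30 (m : nat) (q a b t w v : C)
  (hq0 : (0 < Cmod q)%R) (hq1 : (Cmod q < 1)%R)
  (ha : a <> 0) (hb : b <> 0) (ht : t <> 0)
  (hw : w ^ 2 = q * a * b) (hv : v ^ 2 = q ^ 3 * a * b)
  (hqa : forall k : nat, q * a <> / q ^ k)
  (hqabt : forall k : nat, q ^ 2 * a * b * t <> / q ^ k)
  (hwp : forall k : nat, w <> / q ^ k)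
  (hwm : forall k : nat, - w <> / q ^ k) :
  @is_series C_AbsRing C_NormedModule
    (fun n : nat =>
       t ^ n
       * ((qpoch (q * a * b) q n * qpoch v q n * qpoch (- v) q n
             * qpoch (/ t) q n)
          / (qpoch q q n * qpoch w q n * qpoch (- w) q n
               * qpoch (q ^ 2 * a * b * t) q n))
       * little_qJacobi n (q ^ m) a b q)
    ((qpoch_inf (q ^ 2 * a * b) q * qpoch_inf (q * a * t) q)
       / (qpoch_inf (q * a) q * qpoch_inf (q ^ 2 * a * b * t) q) * t ^ m).
Proof.
  assert (Hq : q <> 0) by now apply Cmod_gt_0.
  assert (Hqq := regular_base q hq1).
  assert (Ha := regular_of_neq _ _ Hq hqa).
  assert (Ht := regular_of_neq _ _ Hq hqabt).
  assert (Hwp := regular_of_neq _ _ Hq hwp).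
  assert (Hwm := regular_of_neq _ _ Hq hwm).
  assert (HA : 1 - q * a * b <> 0).
  (* The two conditions at [k = 0] exclude [w^2 = 1]. *)
  { rewrite <- hw; replace (1 - w ^ 2) with ((1 - w) * (1 - - w)) by ring.
    apply Cmult_neq_0; eapply regular_head; eassumption. }
  generalize (expands_pow_qfall q m 0 a b t Hq hq1 ha Ha Ht); unfold expands.
  simpl (qfall t 1 q 0); rewrite (Cmult_1_r (t ^ m)).
  apply is_series_ext; intros n.
  rewrite little_qJacobi_sum.
  apply f_equal2.
  - unfold kernel.
    rewrite <- vwp_coef_quotient, <- qfall_qpoch; try assumption.
    2:{ intros E; apply HA; rewrite E; ring. }
    assert (H1 := qpoch_neq_0 _ _ n Hqq).
    assert (H2 := qpoch_neq_0 _ _ n Ht).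
    assert (H3 := qpoch_neq_0 _ _ n Hwp).
    assert (H4 := qpoch_neq_0 _ _ n Hwm).
    assert (E := qpoch_sqrt_quotient q (q * a * b) w v n hw
                   ltac:(rewrite hv; ring)).
    replace (1 - q * a * b * q ^ (2 * n))
      with ((1 - q * a * b) * (qpoch v q n * qpoch (- v) q n)
            / (qpoch w q n * qpoch (- w) q n))
      by (rewrite E; field; split; assumption).
    field; repeat split; assumption.
  - apply C_sum_ext; intros k _; simpl (qfall _ _ _ 0); ring.
Qed.
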